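(* Let $F$ be a field of characteristic $2$ and let $L/F$ be a separable algebraic field extension. Let $\phi,\psi$ be either both totally singular quadratic forms over $F$ or both nonsingular symmetric bilinear forms over $F$. Then $\phi$ and $\psi$ are similar over $F$ if and only if $\phi_L$ and $\psi_L$ are similar over $L$.
   Context: Two forms $\phi,\psi$ over a field $E$ are similar if $\phi\cong c\psi$ for some $c\in E^*$. A totally singular quadratic form is one isometric to $a_1x_1^2+\dots+a_nx_n^2$. *)

(* Defs.v *)
From HB Require Import structures.
From mathcomp Require Import all_boot all_order all_algebra separable.
Set Implicit Arguments. Unset Strict Implicit. Unset Printing Implicit Defensive.
Import GRing.Theory.
Local Open Scope ring_scope.

(* An (algebraic) field extension L/F is given by a field embedding iota : F -> L.
   x in L is separable algebraic over F iff it is a root of a separable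
   polynomial with coefficients in F (separable_poly p := coprimep p p^`()). *)
Definition separable_algebraic_ext (F L : fieldType) (iota : {rmorphism F -> L}) :=
  forall x : L, exists p : {poly F}, separable_poly p && root (map_poly iota p) x.

Definition ts_form (E : fieldType) (n : nat) (a : 'rV[E]_n) (x : 'rV[E]_n) : E :=
  \sum_(i < n) a 0 i * x 0 i ^+ 2.

Definition bil_form (E : fieldType) (n : nat) (B : 'M[E]_n) (x y : 'rV[E]_n) : E :=
  (x *m B *m y^T) 0 0.

Definition nonsingular_sym_bil (E : fieldType) (n : nat) (B : 'M[E]_n) : Prop :=
  B^T = B /\ B \in unitmx.

(* A linear map 'rV_m -> 'rV_n, x |-> x *m M, is a linear isomorphism iff
   M is row free and row full (this forces m = n). *)
Definition lin_iso (E : fieldType) (m n : nat) (M : 'M[E]_(m, n)) : bool :=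
  row_free M && row_full M.

Definition ts_similar (E : fieldType) (n m : nat) (a : 'rV[E]_n) (b : 'rV[E]_m) : Prop :=
  exists (c : E) (M : 'M[E]_(m, n)), c != 0 /\ lin_iso M /\
    forall x : 'rV[E]_m, ts_form a (x *m M) = c * ts_form b x.

Definition bil_similar (E : fieldType) (n m : nat) (A : 'M[E]_n) (B : 'M[E]_m) : Prop :=
  exists (c : E) (M : 'M[E]_(m, n)), c != 0 /\ lin_iso M /\
    forall x y : 'rV[E]_m, bil_form A (x *m M) (y *m M) = c * bil_form B x y.

(* Main.v *)
(** Let [q] denote the totally singular form, or [x |-> x A x^T] for a symmetric
    bilinear form of Gram matrix [A]; it is additive in characteristic 2.  A similarity
    [M A M^T = c B] over [L] is rewritten with [N = c M^-1] as
      [q_A(x M) = c q_B(x)],  [q_B(x N) = c q_A(x)],  [M A = B N^T],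
    which no longer couples different entries of [M] and [N] in a product.
    As [L/F] is separable algebraic, [c] and the entries of [M] and [N] lie in the span
    of an [F]-independent family [e] whose squares are [F]-independent and span [c].
    Comparing coefficients gives solutions [(c_i, M_i, N_i)] over [F], with some
    [c_i <> 0].

    Over [F], [M] induces an isomorphism modulo the kernels of [q_B] and [q_A]; it is made
    invertible by adding a map into [ker q_A], which settles the totally singular case.
    In the bilinear case, one is then reduced to two nonsingular forms [B], [A'] with
    the same [q] such that [A'^-1 - B^-1] is alternating with rows in [ker q]; these are
    isometric. *)
Require Import Defs.
From HB Require Import structures.
From mathcomp Require Import all_boot all_order all_algebra separable.
From mathcomp Require Import zify.
From Stdlib Require Import Classical.
Set Implicit Arguments. Unset Strict Implicit. Unset Printing Implicit Defensive.
Import GRing.Theory.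
Local Open Scope ring_scope.

(** * Alternating matrices and congruence in characteristic 2 *)

Lemma addmm_pchar2 (F : fieldType) (m n : nat) (M : 'M[F]_(m, n)) :
  2%N \in [pchar F] -> M + M = 0.
Proof. by move=> ch; apply/matrixP=> i j; rewrite !mxE addrr_pchar2. Qed.

Definition alternating (F : fieldType) (n : nat) (T : 'M[F]_n) :=
  forall x : 'rV[F]_n, x *m T *m x^T = 0.

Lemma alternating_congr (F : fieldType) (m n : nat) (T : 'M[F]_n)
    (P : 'M[F]_(m, n)) :
  alternating T -> alternating (P *m T *m P^T).
Proof.
move=> altT x; have := altT (x *m P).
by rewrite trmx_mul !mulmxA.
Qed.

Lemma alternatingD (F : fieldType) (n : nat) (S T : 'M[F]_n) :
  alternating S -> alternating T -> alternating (S + T).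
Proof. by move=> aS aT x; rewrite mulmxDr mulmxDl aS aT addr0. Qed.

Lemma alternating_add_trmx (F : fieldType) (n : nat) (S : 'M[F]_n) :
  2%N \in [pchar F] -> alternating (S + S^T).
Proof.
move=> ch x; rewrite mulmxDr mulmxDl.
have -> : x *m S^T *m x^T = (x *m S *m x^T)^T by rewrite !trmx_mul trmxK mulmxA.
by rewrite [x *m S *m x^T]mx11_scalar tr_scalar_mx addmm_pchar2.
Qed.

(** The level set [l *m x = 1%:M] spans the space: a vector killed by [l] is a difference of two of
    its points, and any other vector is a multiple of one. *)
Lemma row_eq_on_level (F : fieldType) (n : nat) (l k : 'rV[F]_n) :
  l != 0 -> (forall x : 'cV[F]_n, l *m x = 1%:M -> k *m x = 1%:M) -> k = l.
Proof.
move=> l0 lk.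
have [x0 lx0] : exists x : 'cV[F]_n, l *m x = 1%:M.
  have /rV0Pn [i li] := l0; exists ((l 0 i)^-1 *: delta_mx i 0).
  rewrite -scalemxAr -colE; apply/matrixP=> a b.
  by rewrite !mxE !ord1 mulVf.
apply/rowP=> i.
have lkx (x : 'cV[F]_n) : k *m x = l *m x.
  have [lx|lx] := eqVneq (l *m x) 0.
    have : k *m (x0 + x) = 1%:M by apply: lk; rewrite mulmxDr lx0 lx addr0.
    by rewrite lx mulmxDr (lk _ lx0) -[X in _ = X]addr0 => /addrI.
  have c0 : (l *m x) 0 0 != 0.
    by apply: contra_neq lx => c0; rewrite [l *m x]mx11_scalar c0 raddf0.
  have lxE : l *m x = ((l *m x) 0 0)%:M by rewrite -mx11_scalar.
  have : k *m (((l *m x) 0 0)^-1 *: x) = 1%:M.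
    by apply: lk; rewrite -scalemxAr {2}lxE scale_scalar_mx mulVf.
  rewrite -scalemxAr => /(congr1 (fun M => (l *m x) 0 0 *: M)).
  by rewrite scalerA mulfV // scale1r scale_scalar_mx mulr1 -lxE.
have := congr1 (fun M : 'M[F]_1 => M 0 0) (lkx (delta_mx i 0)).
by rewrite -!colE !mxE.
Qed.

(** A row vector [x] in the kernel equals [- a v] with [a = x u], whence [a (1 + v u) = 0]. *)
Lemma unitmx_rank1_update (F : fieldType) (n : nat) (u : 'cV[F]_n) (v : 'rV[F]_n) :
  (v *m u) 0 0 != -1 -> 1%:M + u *m v \in unitmx.
Proof.
move=> vu; rewrite -row_free_unit -kermx_eq0; apply/eqP/row_matrixP=> i.
set x := row i _; rewrite row0.
have /eqP : x *m (1%:M + u *m v) = 0.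
  by rewrite -row_mul mulmx_ker row0.
rewrite mulmxDr mulmx1 mulmxA [x *m u]mx11_scalar mul_scalar_mx.
set a := (x *m u) 0 0; rewrite addr_eq0 => /eqP xE.
have /eqP : a * (1 + (v *m u) 0 0) = 0.
  have aE : a = - (a * (v *m u) 0 0).
    by rewrite {1}/a xE mulNmx -scalemxAl 2!mxE.
  by rewrite mulrDr mulr1 {1}aE addNr.
rewrite mulf_eq0 addrC addr_eq0 (negPf vu) orbF => /eqP a0.
by rewrite xE a0 scale0r oppr0.
Qed.

(* [G + T] is reached from [G] by rank 2 steps [G + z^T w + w^T z], with [z], [w]
   in the row space of [T]; such a step is the congruence by
   [1 + G^-1 z^T w], which is invertible iff [w G^-1 z^T <> 1].  A good pair
   [(z, w)] exists since otherwise [T G^-1 T = T], making [G + T] singular. *)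
Lemma congruent_add_alternating (F : fieldType) (n : nat) (G T : 'M[F]_n) :
  2%N \in [pchar F] -> G^T = G -> G \in unitmx -> T^T = T -> alternating T ->
  alternating (T *m invmx G *m T) -> G + T \in unitmx ->
  exists U : 'M[F]_n, U^T *m G *m U = G + T.
Proof.
move=> ch; have [k] := ubnP (\rank T); elim: k T G => // k IHk T G.
rewrite ltnS => rT Gs Gu Ts Talt TBT GTu.
have [->|T0] := eqVneq T 0.
  by exists 1%:M; rewrite trmx1 mul1mx mulmx1 addr0.
set B := invmx G.
have Bs : B^T = B by rewrite trmx_inv Gs.
have [[e1 [e2 [e12 h]]]|noe] := classic (exists e1 e2 : 'rV[F]_n,
   e1 *m T *m e2^T = 1%:M /\ e1 *m T *m B *m T *m e2^T <> 1%:M); last first.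
  case/negP: T0; apply/eqP.
  have TBTE : T *m B *m T = T.
    apply/row_matrixP=> i; rewrite !row_mul.
    have [->|Ti0] := eqVneq (row i T) 0; first by rewrite !mul0mx.
    apply: row_eq_on_level Ti0 _ => x Tx; apply: NNPP => TBTx.
    apply: noe; exists (delta_mx 0 i), x^T.
    by rewrite trmxK -rowE.
  have : (G + T) *m (B *m T) = 0.
    by rewrite mulmxDl !mulmxA mulmxV // mul1mx TBTE addmm_pchar2.
  move/(congr1 (mulmx (G *m invmx (G + T)))); rewrite mulmx0.
  by rewrite !mulmxA -(mulmxA G) mulVmx // mulmx1 mulmxV // mul1mx.
have [z zE] : {z | z = e1 *m T} by exists (e1 *m T).
have [w wE] : {w | w = e2 *m T} by exists (e2 *m T).
have zTE : z^T = T *m e1^T by rewrite zE trmx_mul Ts.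
have wTE : w^T = T *m e2^T by rewrite wE trmx_mul Ts.
have [u uE] : {u | u = B *m z^T} by exists (B *m z^T).
(* This kills the term [w^T z B z^T w] in the expansion of [U^T G U]. *)
have zBz : z *m B *m z^T = 0.
  by have := TBT e1; rewrite zTE zE !mulmxA.
have wu : (w *m u) 0 0 != -1.
  rewrite oppr_pchar2 //; apply/eqP => wu1; apply: h.
  have : (w *m u)^T = 1%:M by rewrite [w *m u]mx11_scalar wu1 tr_scalar_mx.
  by rewrite uE !trmx_mul wTE zE !trmxK Bs !mulmxA.
pose U := 1%:M + u *m w; have Uu : U \in unitmx by apply: unitmx_rank1_update.
pose T0' := z^T *m w + w^T *m z.
have [G1 G1D] : {G1 | G1 = U^T *m G *m U} by exists (U^T *m G *m U).
have UT : U^T = 1%:M + w^T *m z *m B.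
  by rewrite /U uE linearD /= trmx1 !trmx_mul !trmxK Bs !mulmxA.
have G1E : G1 = G + T0'.
  rewrite G1D UT /U mulmxDl mul1mx mulmxKV // mulmxDr mulmx1 mulmxDl.
  rewrite uE !mulmxA mulmxV // mul1mx -!(mulmxA w^T) zBz mul0mx mulmx0 addr0.
  by rewrite /T0' [z^T *m w + _]addrC addrA.
have G1u : G1 \in unitmx by rewrite G1D !unitmx_mul unitmx_tr Uu Gu.
have G1s : G1^T = G1 by rewrite G1D !trmx_mul trmxK Gs mulmxA.
(* [T + T0'] factors as [T X^T], and [X^T] annihilates the nonzero vector [z] of the row space of
   [T], so the rank drops. *)
pose X := 1%:M + T *m (e1^T *m e2 + e2^T *m e1).
have XT : T + T0' = X *m T.
  by rewrite /X /T0' zTE wTE zE wE mulmxDl mul1mx mulmxDr mulmxDl !mulmxA.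
have T1s : (T + T0')^T = T + T0'.
  by rewrite !linearD /= Ts !trmx_mul !trmxK [w^T *m z + _]addrC.
have T1alt : alternating (T + T0').
  apply: alternatingD => //; rewrite /T0' -[w^T *m z]trmxK.
  by rewrite trmx_mul trmxK; apply: alternating_add_trmx.
have e11 : e1 *m T *m e1^T = 0 := Talt e1.
have zT1 : z *m X^T = 0.
  have -> : z *m X^T = e1 *m (X *m T)^T by rewrite trmx_mul Ts zE mulmxA.
  rewrite -XT T1s /T0' !mulmxDr zTE wTE zE wE !mulmxA e12 e11.
  by rewrite !mul0mx mul1mx add0r addmm_pchar2.
have TX : T + T0' = T *m X^T by rewrite -T1s XT trmx_mul Ts.
have rT1 : (\rank (T + T0')%R < k)%N.
  apply: leq_trans rT; rewrite TX.
  rewrite -(mxrank_mul_ker T X^T) -[X in (X < _)%N]addn0 ltn_add2l lt0n.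
  rewrite mxrank_eq0; apply: contraTneq isT => cap0.
  have : (z <= (T :&: kermx X^T)%MS)%MS.
    by rewrite sub_capmx zE submxMl -zE; apply/sub_kermxP.
  rewrite cap0 submx0 zE => /eqP z0; move: e12; rewrite z0 mul0mx.
  by move/matrixP/(_ 0 0)/eqP; rewrite !mxE eq_sym oner_eq0.
(* [V] is built so that [V T = T U]; hence [T G1^-1 T] is congruent to [T B T] and is again
   alternating. *)
pose V := 1%:M + (T *m u) *m e2.
have Vu : V \in unitmx.
  by apply: unitmx_rank1_update; rewrite mulmxA -wE.
have VT : V *m T = T *m U.
  by rewrite /V /U mulmxDl mulmxDr mul1mx mulmx1 wE !mulmxA.
have UB : U *m invmx G1 *m U^T = B.
  have : U^T *m G *m (U *m invmx G1) = 1%:M by rewrite mulmxA -G1D mulmxV.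
  move/mulmx1C; rewrite mulmxA => UG.
  by rewrite -[LHS](mulmxK Gu) UG mul1mx.
have TB1T : alternating (T *m invmx G1 *m T).
  have -> : T *m invmx G1 *m T
      = invmx V *m (T *m B *m T) *m (invmx V)^T.
    have TE : invmx V *m T *m U = T by rewrite -mulmxA -VT (mulKmx Vu).
    have TE' : U^T *m T *m (invmx V)^T = T.
      by have := congr1 trmx TE; rewrite !trmx_mul Ts mulmxA.
    by rewrite -UB -{1}TE -{2}TE' !mulmxA.
  exact: alternating_congr.
have [||W WE] := IHk (T + T0') G1 rT1 G1s G1u T1s T1alt.
- rewrite {1}XT TX.
  have -> : X *m T *m invmx G1 *m (T *m X^T) = X *m (T *m invmx G1 *m T) *m X^T.
    by rewrite !mulmxA.
  exact: alternating_congr.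
- by rewrite G1E addrACA [T0' + T0']addmm_pchar2 // addr0.
exists (U *m W); rewrite trmx_mul -!mulmxA (mulmxA G) (mulmxA U^T) (mulmxA U^T).
by rewrite -G1D mulmxA WE G1E addrACA [T0' + T0']addmm_pchar2 // addr0.
Qed.

(** * Totally singular forms as Frobenius-semilinear maps *)

Lemma twisted_linear_ts_form (F : fieldType) (n : nat) (f : 'rV[F]_n -> F) :
  (forall x y, f (x + y) = f x + f y) ->
  (forall k x, f (k *: x) = k ^+ 2 * f x) ->
  forall x, f x = ts_form (\row_i f 'e_i) x.
Proof.
move=> fD fZ x.
have f0 : f 0 = 0 by rewrite -(scale0r (0 : 'rV_n)) fZ expr2 !mul0r.
rewrite {1}[x]row_sum_delta /ts_form (big_morph f fD f0).
by apply: eq_bigr => i _; rewrite fZ mxE mulrC.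
Qed.

Section TotallySingular.
Variables (F : fieldType) (ch : 2%N \in [pchar F]).
Implicit Types n m : nat.

Lemma sqrrD_pchar2 (x y : F) : (x + y) ^+ 2 = x ^+ 2 + y ^+ 2.
Proof. exact: (pFrobenius_autD_comm ch (mulrC x y)). Qed.

Lemma ts_formD n (a x y : 'rV[F]_n) : ts_form a (x + y) = ts_form a x + ts_form a y.
Proof.
rewrite /ts_form -big_split; apply: eq_bigr => i _.
by rewrite mxE sqrrD_pchar2 mulrDr.
Qed.

Lemma ts_formZ n (a x : 'rV[F]_n) k : ts_form a (k *: x) = k ^+ 2 * ts_form a x.
Proof.
rewrite /ts_form mulr_sumr; apply: eq_bigr => i _.
by rewrite mxE exprMn mulrCA.
Qed.

Lemma ts_form_similarityP n m (a : 'rV[F]_n) (b : 'rV[F]_m) (M : 'M[F]_(m, n)) c :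
  (forall x : 'rV[F]_m, ts_form a (x *m M) = c * ts_form b x) <->
  (forall j, ts_form a (row j M) = c * b 0 j).
Proof.
have bE j : ts_form b 'e_j = b 0 j.
  rewrite /ts_form (bigD1 j) //= mxE !eqxx expr1n mulr1 big1 ?addr0 // => i ij.
  by rewrite mxE eqxx (negPf ij) expr0n mulr0.
split=> [H j|H x]; first by rewrite rowE H bE.
rewrite (@twisted_linear_ts_form _ _ (fun x => ts_form a (x *m M))).
- rewrite /ts_form mulr_sumr; apply: eq_bigr => i _.
  by rewrite mxE -rowE -/(ts_form a _) H mulrA.
- by move=> y z; rewrite mulmxDl ts_formD.
- by move=> k y; rewrite -scalemxAl ts_formZ.
Qed.

(** The cross terms [y A z^T] and [z A y^T] are equal and cancel, so [x A x^T] is additive and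
    determined by its values on unit vectors. *)
Lemma sym_diag_ts_form n (A : 'M[F]_n) : A^T = A ->
  forall x : 'rV[F]_n, x *m A *m x^T = (ts_form (\row_i A i i) x)%:M.
Proof.
move=> As x; rewrite [LHS]mx11_scalar; congr _%:M.
rewrite (@twisted_linear_ts_form _ _ (fun x => (x *m A *m x^T) 0 0)).
- congr ts_form; apply/rowP=> i; rewrite mxE [in RHS]mxE /=.
  by rewrite trmx_delta -colE -rowE !mxE.
- move=> y z; rewrite linearD /= mulmxDr !mulmxDl.
  have -> : z *m A *m y^T = (y *m A *m z^T)^T.
    by rewrite !trmx_mul trmxK As mulmxA.
  set s := y *m A *m z^T; rewrite -addrA [s^T + _]addrA.
  by rewrite [s]mx11_scalar tr_scalar_mx addmm_pchar2 // add0r mxE.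
- move=> k y; rewrite linearZ /= -!scalemxAl -scalemxAr !mxE.
  by rewrite mulrA expr2.
Qed.

(** The form being additive, a subspace of zeros can be enlarged by any zero outside it; the
    induction on codimension stops when none is left. *)
Lemma ts_form_kernel n (a : 'rV[F]_n) :
  exists Z : 'M[F]_n, forall x : 'rV_n, (x <= Z)%MS = (ts_form a x == 0).
Proof.
pose iso (Z : 'M[F]_n) := forall x : 'rV_n, (x <= Z)%MS -> ts_form a x = 0.
suff: forall k (Z : 'M[F]_n), (n - \rank Z < k)%N -> iso Z ->
    exists Z' : 'M[F]_n, forall x : 'rV_n, (x <= Z')%MS = (ts_form a x == 0).
  move=> H; apply: (H n.+1 0); first by rewrite mxrank0 subn0.
  move=> x; rewrite submx0 => /eqP ->.
  by rewrite -(scale0r (0 : 'rV_n)) ts_formZ expr2 !mul0r.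
elim=> // k IHk Z rZ isoZ.
have [[x [xZ ax]]|all] := classic (exists x : 'rV_n, ~~ (x <= Z)%MS /\ ts_form a x = 0).
  apply: (IHk (Z + x)%MS).
    have lt : (\rank Z < \rank (Z + x)%MS)%N.
      apply: rank_ltmx; rewrite ltmxE addsmxSl /=.
      by apply: contra xZ; apply: submx_trans; rewrite addsmxSr.
    by have := rank_leq_col (Z + x)%MS; lia.
  move=> y /sub_addsmxP [[u v] /= ->]; rewrite ts_formD isoZ ?submxMl // add0r.
  by rewrite [v]mx11_scalar mul_scalar_mx ts_formZ ax mulr0.
exists Z => x; apply/idP/eqP; first exact: isoZ.
by move=> ax; apply: contra_notT all => xZ; exists x.
Qed.

End TotallySingular.

(** * Correcting a map to an invertible one *)

Section Correction.
Variables (F : fieldType) (n : nat) (M ZA ZB : 'M[F]_n).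
Hypothesis MZ : forall x : 'rV[F]_n, (x *m M <= ZA)%MS = (x <= ZB)%MS.

(** Rank-nullity for [M] restricted to [ZB]: the image is [ZA :&: M], and [MZ] puts all of [kermx M]
    inside [ZB]. *)
Lemma rank_cap_preim : (\rank (ZA :&: M) + \rank (kermx M))%N = \rank ZB.
Proof.
rewrite -(mxrank_mul_ker ZB M); congr (_ + _)%N.
  apply/eqmx_rank/rV_eqP => x; apply/idP/idP.
    by rewrite sub_capmx => /andP [xZ /submxP [D xE]]; rewrite xE submxMr // -MZ -xE.
  case/submxP=> D ->; rewrite sub_capmx mulmxA submxMl andbT MZ.
  exact: submxMl.
have kZ : (kermx M <= ZB)%MS.
  by apply/rV_subP => x /sub_kermxP xM; rewrite -MZ xM sub0mx.
by rewrite (capmx_idPr kZ).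
Qed.

(** By [MZ], [M] induces an injection of the quotient by [ZB] into the quotient by [ZA]. *)
Lemma rank_preim_le : (\rank ZA <= \rank ZB)%N.
Proof.
have := rank_cap_preim; have := mxrank_sum_cap ZA M.
have := rank_leq_row (ZA + M)%MS; have := mxrank_ker M; have := rank_leq_row M.
lia.
Qed.

(** For equal ranks, [ZA :&: M] has a complement in [ZA] of the dimension of [kermx M]. As [S] is
    injective on this kernel, some [S *m Q] maps the kernel onto the complement, which meets the
    image of [M] trivially. The factor [S] prescribes the shape of the correction for the bilinear
    case. *)
Lemma unitmx_correction (S : 'M[F]_n) : \rank ZA = \rank ZB ->
  (forall x : 'rV[F]_n, x *m M = 0 -> x *m S = 0 -> x = 0) ->
  exists2 Q : 'M[F]_n, (Q <= ZA)%MS & M + S *m Q \in unitmx.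
Proof.
move=> rZ MS.
have rk : \rank (ZA :\: M)%MS = \rank (kermx M).
  by have := mxrank_cap_compl ZA M; have := rank_cap_preim; lia.
have [W Wf WE] : exists2 W : 'M[F]_(\rank (kermx M), n),
    row_free W & (W :=: ZA :\: M)%MS.
  rewrite -rk; exists (row_base (ZA :\: M)%MS); first exact: row_base_free.
  exact: eq_row_base.
have [K Kf KE] : exists2 K : 'M[F]_(\rank (kermx M), n), row_free K & (K :=: kermx M)%MS.
  by exists (row_base (kermx M)); [exact: row_base_free | exact: eq_row_base].
have KM : K *m M = 0 by apply/sub_kermxP; rewrite KE.
have : row_free (K *m S).
  rewrite -kermx_eq0; apply/eqP/row_matrixP => i; rewrite row0.
  set y := row i _.
  have yKS : y *m (K *m S) = 0 by rewrite /y -row_mul mulmx_ker row0.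
  have yK : y *m K = 0 by apply: MS; rewrite -mulmxA // KM mulmx0.
  by apply/eqP; rewrite -(mulmx_free_eq0 y Kf) yK.
case/row_freeP => J KSJ.
have WM : (W :&: M)%MS = 0.
  by apply/eqP; rewrite -submx0 -(capmx_diff ZA M) capmxS // WE.
exists (J *m W); first by rewrite mulmx_sub // WE diffmxSl.
rewrite -row_free_unit -kermx_eq0; apply/eqP/row_matrixP => i; rewrite row0.
set x := row i _.
have : x *m (M + S *m (J *m W)) = 0 by rewrite /x -row_mul mulmx_ker row0.
rewrite mulmxDr => /eqP; rewrite addr_eq0 => /eqP xM.
have xM0 : x *m M = 0.
  apply/eqP; rewrite -submx0 -WM sub_capmx submxMl andbT xM !mulmxA.
  by rewrite -mulNmx submxMl.
have /submxP [y xE] : (x <= K)%MS by rewrite KE; apply/sub_kermxP.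
move/eqP: xM; rewrite xM0 eq_sym oppr_eq0 !mulmxA mulmx_free_eq0 // xE.
by rewrite -!mulmxA (mulmxA K) KSJ mulmx1 => /eqP ->; rewrite mul0mx.
Qed.

End Correction.

(** * Similarity over the base field from a pair of maps *)

Lemma ts_similar_kernel (F : fieldType) (n : nat) (a b : 'rV[F]_n) (c : F)
    (M ZA ZB : 'M[F]_n) : c != 0 ->
  (forall x, ts_form a (x *m M) = c * ts_form b x) ->
  (forall x : 'rV[F]_n, (x <= ZA)%MS = (ts_form a x == 0)) ->
  (forall x : 'rV[F]_n, (x <= ZB)%MS = (ts_form b x == 0)) ->
  forall x : 'rV[F]_n, (x *m M <= ZA)%MS = (x <= ZB)%MS.
Proof.
by move=> c0 MP ZAP ZBP x; rewrite ZAP ZBP MP mulf_eq0 (negPf c0).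
Qed.

(** [M] and [N] give opposite inequalities between the ranks of the two kernels; a correction of [M]
    with rows in the kernel of [ts_form a] leaves the values unchanged. *)
Lemma ts_similar_of_maps (F : fieldType) (n : nat) (a b : 'rV[F]_n) (c : F)
    (M N : 'M[F]_n) : 2%N \in [pchar F] -> c != 0 ->
  (forall x, ts_form a (x *m M) = c * ts_form b x) ->
  (forall x, ts_form b (x *m N) = c * ts_form a x) ->
  exists2 P : 'M[F]_n, P \in unitmx &
    forall x, ts_form a (x *m P) = c * ts_form b x.
Proof.
move=> ch c0 MP NP.
have [ZA ZAP] := ts_form_kernel ch a; have [ZB ZBP] := ts_form_kernel ch b.
have MZ := ts_similar_kernel c0 MP ZAP ZBP.
have NZ := ts_similar_kernel c0 NP ZBP ZAP.
have rZ : \rank ZA = \rank ZB.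
  by apply/eqP; rewrite eqn_leq (rank_preim_le MZ) (rank_preim_le NZ).
have [|Q QZ Pu] := unitmx_correction (S := 1%:M) MZ rZ.
  by move=> x _; rewrite mulmx1.
rewrite mul1mx in Pu; exists (M + Q) => // x.
rewrite mulmxDr ts_formD // MP; have /eqP -> : ts_form a (x *m Q) == 0.
  by rewrite -ZAP mulmx_sub.
by rewrite addr0.
Qed.

Lemma bil_similar_of_maps (F : fieldType) (n : nat) (A B : 'M[F]_n) (c : F)
    (M N : 'M[F]_n) : 2%N \in [pchar F] -> c != 0 ->
  nonsingular_sym_bil A -> nonsingular_sym_bil B ->
  (forall x, ts_form (\row_i A i i) (x *m M) = c * ts_form (\row_i B i i) x) ->
  (forall x, ts_form (\row_i B i i) (x *m N) = c * ts_form (\row_i A i i) x) ->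
  M *m A = B *m N^T ->
  exists2 P : 'M[F]_n, P \in unitmx & P *m A *m P^T = c *: B.
Proof.
move=> ch c0 [As Au] [Bs Bu].
have qA := sym_diag_ts_form ch As; have qB := sym_diag_ts_form ch Bs.
move: (\row_i A i i) (\row_i B i i) qA qB => a b qA qB MP NP MN.
have [ZA ZAP] := ts_form_kernel ch a; have [ZB ZBP] := ts_form_kernel ch b.
have MZ := ts_similar_kernel c0 MP ZAP ZBP.
have NZ := ts_similar_kernel c0 NP ZBP ZAP.
have rZ : \rank ZA = \rank ZB.
  by apply/eqP; rewrite eqn_leq (rank_preim_le MZ) (rank_preim_le NZ).
(* [N] is onto modulo [ZB]. If [x M = 0] then [x B N^T = x M A = 0], so [x B ZB^T = 0] forces
   [x B = 0]: this is the injectivity asked of [S]. *)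
have NZfull : row_full (N + ZB)%MS.
  have := rank_cap_preim NZ; have := mxrank_sum_cap ZB N.
  have := mxrank_ker N; have := rank_leq_row N; rewrite /row_full addsmxC.
  by move=> *; apply/eqP; lia.
have [|Q QZ Pu] := unitmx_correction (S := B *m ZB^T) MZ rZ.
  move=> x xM xS.
  have : (1%:M <= N + ZB)%MS by rewrite submx_full.
  case/sub_addsmxP => [[u v] /= uv].
  have xB : x *m B = 0.
    rewrite -[LHS]mulmx1 -trmx1 uv linearD /= mulmxDr !trmx_mul !mulmxA.
    by rewrite -(mulmxA x B) -MN mulmxA xM !mul0mx -(mulmxA x B) xS mul0mx addr0.
  by rewrite -[x](mulmxK Bu) xB mul0mx.
(* The left factor [B ZB^T] of the correction lets [N] be corrected as well, by rows in [ZB], so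
   that [M A = B N^T] persists as [P A = B N'^T]. *)
set P := M + _ in Pu; pose N' := N + A *m Q^T *m ZB.
have PN : P *m A = B *m N'^T.
  by rewrite /P /N' mulmxDl MN linearD /= mulmxDr !trmx_mul trmxK As !mulmxA.
have PP x : ts_form a (x *m P) = c * ts_form b x.
  rewrite mulmxDr ts_formD // MP; have /eqP -> : ts_form a (x *m (B *m ZB^T *m Q)) == 0.
    by rewrite -ZAP !mulmx_sub.
  by rewrite addr0.
have N'P x : ts_form b (x *m N') = c * ts_form a x.
  rewrite mulmxDr ts_formD // NP; have /eqP -> : ts_form b (x *m (A *m Q^T *m ZB)) == 0.
    by rewrite -ZBP !mulmx_sub.
  by rewrite addr0.
clearbody P N'; move: Pu PN PP N'P => {M N MP NP MN MZ NZ NZfull QZ Q} Pu PN PP NP.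
(* [A'] has the same quadratic form as [B]; the congruence is sought between the inverses [G] and
   [G']. *)
pose G := invmx B; pose A' := c^-1 *: (P *m A *m P^T).
pose G' := c *: ((invmx P)^T *m invmx A *m invmx P).
have Gs : G^T = G by rewrite trmx_inv Bs.
have Gu : G \in unitmx by rewrite unitmx_inv.
have GA' : G' *m A' = 1%:M.
  rewrite -scalemxAl -scalemxAr scalerA mulfV // scale1r !mulmxA.
  by rewrite mulmxKV // mulmxKV // -trmx_mul mulmxV // trmx1.
have A'G : A' *m G' = 1%:M by apply: mulmx1C.
have A's : A'^T = A' by rewrite linearZ /= !trmx_mul trmxK As mulmxA.
have qA' x : x *m A' *m x^T = (ts_form b x)%:M.
  rewrite -scalemxAr -scalemxAl !mulmxA -(mulmxA _ P^T) -trmx_mul qA PP.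
  by rewrite scale_scalar_mx mulKf.
have [T TE] : {T | T = G' + G} by exists (G' + G).
have GT : G + T = G' by rewrite TE addrCA addmm_pchar2 // addr0.
have G's : G'^T = G' by rewrite linearZ /= !trmx_mul trmxK (trmx_inv A) As mulmxA.
have Ts : T^T = T by rewrite TE linearD /= G's Gs.
have TK : T = (invmx P)^T *m invmx A *m (c *: invmx P + N').
  rewrite TE mulmxDr -scalemxAr; congr (_ + _).
  have : P^T *m G = invmx A *m N'.
    rewrite -[RHS](mulmxK Bu) -(mulmxA _ _ B).
    have -> : N' *m B = A *m P^T by rewrite -[LHS]trmxK trmx_mul Bs -PN trmx_mul As.
    by rewrite mulKmx.
  by move=> E; rewrite -mulmxA -E mulmxA -trmx_mul mulmxV // trmx1 mul1mx.
(* The two summands of [T] contribute equally: on [y N'] the form [b] is [c] times [a] at [y], and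
   on [c y P^-1] it is [c^2] times [b] at [y P^-1], which is the same. *)
have bT (x : 'rV_n) : ts_form b (x *m T) = 0.
  rewrite TK mulmxA; move: (x *m _) => y.
  rewrite mulmxDr ts_formD // NP -{2}[y](mulmxKV Pu) PP -scalemxAr ts_formZ //.
  by rewrite mulrA -expr2 addrr_pchar2.
have BTA : B *m T *m A' = A' + B.
  by rewrite TE mulmxDr mulmxDl -mulmxA GA' mulmx1 mulmxV // mul1mx addrC.
have ATB : A' *m T *m B = A' + B.
  by rewrite TE mulmxDr mulmxDl A'G mul1mx -mulmxA mulVmx // mulmx1 addrC.
(* [B T B] is the sum of [A' + B], alternating as both have the same quadratic form, and of
   [B T A' T B], alternating as that form vanishes on the rows of [T]. *)
have altT : alternating T.
  have -> : T = G *m (A' + B + B *m T *m A' *m (B *m T)^T) *m G^T.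
    have -> : A' + B + B *m T *m A' *m (B *m T)^T = B *m T *m B.
      rewrite -{1}ATB trmx_mul Ts Bs BTA mulmxDl !mulmxA addrA addmm_pchar2 //.
      by rewrite add0r.
    by rewrite Gs !mulmxA mulVmx // mul1mx mulmxK.
  apply: alternating_congr; apply: alternatingD.
    by move=> x; rewrite mulmxDr mulmxDl qA' qB addmm_pchar2.
  move=> x; have := qA' (x *m (B *m T)).
  by rewrite trmx_mul !mulmxA => ->; rewrite bT raddf0.
have [||U UE] := congruent_add_alternating ch Gs Gu Ts altT.
- by move=> x; rewrite invmxK -{2}Ts -!mulmxA -trmx_mul !mulmxA qB bT raddf0.
- by rewrite GT; case/mulmx1_unit: GA'.
have UP : U *m A' *m U^T = B.
  have : U^T *m G *m (U *m A') = 1%:M by rewrite mulmxA UE GT GA'.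
  move/mulmx1C; rewrite mulmxA => UG.
  by rewrite -[LHS](mulmxK Gu) UG mul1mx invmxK.
have UPE : U *m P *m A *m (U *m P)^T = c *: B.
  by rewrite -UP /A' -scalemxAr -scalemxAl scalerA mulfV // scale1r trmx_mul !mulmxA.
exists (U *m P) => //.
have : c *: B \in unitmx by rewrite unitmxZ // unitfE.
by rewrite -UPE !unitmx_mul => /andP [/andP [-> _] _].
Qed.

(** * Separable extensions and spans of squares *)

(** Since [r \Po 'X^2 = q * p] has zero derivative and [p] is coprime to its own derivative, [p]
    divides [q]. So [p * p] divides a polynomial which, if nonzero, has smaller degree. *)
Lemma separable_dvd_comp_Xsq (F : fieldType) (p r : {poly F}) :
  2%N \in [pchar F] -> separable_poly p -> (size r < size p)%N ->
  p %| r \Po 'X^2 -> r = 0.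
Proof.
move=> ch sepp sr /dvdpP [q E].
have p0 : p != 0 by rewrite -size_poly_gt0 (leq_trans _ sr).
have cop : coprimep p p^`() by move: sepp; rewrite separable_poly.unlock.
have X2' : ('X^2 : {poly F})^`() = 0.
  by rewrite derivXn -mulr_natr (_ : 2%:R = 0) ?mulr0 // -polyC_natr pcharf0 // polyC0.
have pq : p %| q.
  rewrite -(Gauss_dvdpl _ cop).
  have : (q * p)^`() = 0 by rewrite -E deriv_comp X2' mulr0.
  rewrite derivM => /eqP; rewrite addr_eq0 => /eqP qp.
  have -> : q * p^`() = - (q^`() * p) by rewrite qp opprK.
  by rewrite -mulNr dvdp_mull.
apply/eqP; rewrite -(comp_poly_eq0 r (q := 'X^2)) ?size_polyXn //.
apply: contraT => g0; exfalso.
have : (0 < size r)%N.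
  by rewrite size_poly_gt0; apply: contra_neq g0 => ->; rewrite comp_poly0.
have : p * p %| r \Po 'X^2 by rewrite E mulrC dvdp_mul2r.
move/(dvdp_leq g0); rewrite size_mul //.
have := size_comp_poly_leq r 'X^2; rewrite size_polyXn /= => h1 h2 r0.
move: (leq_trans h2 h1) r0 sr; move: (size r) (size p) => u v; lia.
Qed.

Section Descent.
Variables (F L : fieldType) (f : {rmorphism F -> L}) (ch : 2%N \in [pchar F]).

Let chL : 2%N \in [pchar L]. Proof. by rewrite (fmorph_pchar f). Qed.

Definition closed_subspace (W : L -> Prop) :=
  [/\ W 0, forall u v, W u -> W v -> W (u + v) & forall c u, W u -> W (f c * u)].

(* The span of [s] is contained in the span of the squares of [s], the span
   being the intersection of all subspaces. *)
Definition spanned_by_squares (s : seq L) := forall W, closed_subspace W ->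
  (forall w, w \in s -> W (w ^+ 2)) -> forall y, y \in s -> W y.

Lemma closed_subspace_sum (W : L -> Prop) n (k : 'I_n -> F) (u : 'I_n -> L) :
  closed_subspace W -> (forall i, W (u i)) -> W (\sum_i f (k i) * u i).
Proof.
case=> W0 WD WZ Wu; apply: (big_ind W) => // i _; exact: WZ.
Qed.

(* [F(x) = F(x^2)]: squaring the powers [1, .., x^(d-1)] gives independent
   elements modulo [p], hence again a basis. *)
Lemma powers_spanned_by_squares (p : {poly F}) (x : L) :
  separable_poly p -> root (map_poly f p) x ->
  exists s : seq L, x \in s /\ spanned_by_squares s.
Proof.
move=> sepp px.
have p0 : p != 0.
  apply: contraTneq sepp => ->.
  by rewrite separable_poly.unlock deriv0 coprimep0 -size_poly_eq1 size_poly0.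
set d := (size p).-1.
have sp : size p = d.+1 by rewrite /d prednK // size_poly_gt0.
have d0 : (0 < d)%N.
  rewrite lt0n; apply: contraTneq px => d0.
  have /eqP/size_poly1P [c c0 ->] : size p = 1%N by rewrite sp d0.
  by rewrite map_polyC rootC fmorph_eq0.
(* [h r] holds the coordinates of [r \Po 'X^2] modulo [p], so the rows of [C] are those of the
   squared powers. *)
pose h (r : {poly F}) : 'rV[F]_d := poly_rV ((r \Po 'X^2) %% p).
have hD r q : h (r + q) = h r + h q by rewrite /h comp_polyD modpD linearD.
have hZ k r : h (k *: r) = k *: h r by rewrite /h comp_polyZ modpZl linearZ.
have h0 : h 0 = 0 by rewrite /h comp_poly0 mod0p linear0.
pose C := \matrix_(j < d) h 'X^j.
have mulC (k : 'rV_d) : k *m C = h (rVpoly k).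
  rewrite mulmx_sum_row /rVpoly poly_def (big_morph h hD h0).
  by apply: eq_bigr => j _; rewrite hZ rowK valK.
have sm (q : {poly F}) : (size (q %% p)%R <= d)%N.
  by rewrite -ltnS -sp ltn_modp.
have Cu : C \in unitmx.
  rewrite -row_free_unit -kermx_eq0; apply/eqP/row_matrixP => i; rewrite row0.
  set k := row i _; have : k *m C = 0 by rewrite /k -row_mul mulmx_ker row0.
  rewrite mulC => /(congr1 rVpoly); rewrite poly_rV_K // linear0 => /modp_eq0P pd.
  rewrite -[k]rVpolyK (separable_dvd_comp_Xsq ch sepp _ pd) ?linear0 //.
  by rewrite sp ltnS size_poly.
(* Going up to [x ^+ d] keeps [x] in the list when [d = 1]. *)
exists (mkseq (fun i => x ^+ i) d.+1).
have inS i : (i <= d)%N -> x ^+ i \in mkseq (fun i => x ^+ i) d.+1.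
  by move=> id; apply/mapP; exists i => //; rewrite mem_iota.
split=> [|W Wsub Wsq _ /mapP [i _ ->]]; first by rewrite -[X in X \in _]expr1 inS.
pose v := poly_rV ('X^i %% p) *m invmx C.
have xiE : x ^+ i = \sum_(j < d) f (v 0 j) * (x ^+ j) ^+ 2.
  have -> : x ^+ i = (map_poly f ('X^i %% p)).[x].
    by rewrite map_modp horner_mod // map_polyXn hornerXn.
  have -> : 'X^i %% p = (rVpoly v \Po 'X^2) %% p.
    rewrite -[LHS](poly_rV_K (sm _)) -[RHS](poly_rV_K (sm _)); congr rVpoly.
    by rewrite -/(h (rVpoly v)) -mulC /v mulmxKV.
  rewrite map_modp horner_mod // map_comp_poly map_polyXn horner_comp hornerXn.
  rewrite (@horner_coef_wide _ d) ?(leq_trans (size_poly _ _)) ?size_poly //.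
  by apply: eq_bigr => j _; rewrite coef_map coef_rVpoly_ord -!exprM mulnC.
by rewrite xiE; apply: closed_subspace_sum => // j; apply/Wsq/inS/ltnW.
Qed.

(** A subspace containing the squares of a concatenation contains those of each part, so the
    elements of [s] can be treated one at a time. *)
Lemma seq_spanned_by_squares (s : seq L) : separable_algebraic_ext f ->
  exists t : seq L, {subset s <= t} /\ spanned_by_squares t.
Proof.
move=> sep; elim: s => [|x s [t [st tP]]]; first by exists [::].
have [p /andP [sepp px]] := sep x.
have [u [xu uP]] := powers_spanned_by_squares sepp px.
exists (u ++ t); split=> [y|W WP Wsq y].
  by rewrite inE mem_cat => /predU1P [->|/st ->]; rewrite ?xu ?orbT.
by rewrite mem_cat => /orP []; [apply: uP | apply: tP] => // w wi;
  apply: Wsq; rewrite mem_cat wi ?orbT.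
Qed.

Definition lincomb N (e : 'cV[L]_N) (k : 'rV[F]_N) : 'M[L]_1 := map_mx f k *m e.

Definition independent N (e : 'cV[L]_N) := forall k, lincomb e k = 0 -> k = 0.

Definition squares N (e : 'cV[L]_N) : 'cV[L]_N := map_mx (fun z => z ^+ 2) e.

Lemma lincombD N (e : 'cV[L]_N) k l : lincomb e (k + l) = lincomb e k + lincomb e l.
Proof. by rewrite /lincomb map_mxD mulmxDl. Qed.

Lemma lincombZ N (e : 'cV[L]_N) c k : lincomb e (c *: k) = f c *: lincomb e k.
Proof. by rewrite /lincomb map_mxZ scalemxAl. Qed.

Lemma lincomb_sum N (e : 'cV[L]_N) n (k : 'I_n -> 'rV[F]_N) :
  lincomb e (\sum_i k i) = \sum_i lincomb e (k i).
Proof. by rewrite /lincomb map_mx_sum mulmx_suml. Qed.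

(** The Frobenius map of [L] is a ring morphism and is applied to the whole combination. *)
Lemma lincomb_squares N (e : 'cV[L]_N) k y : lincomb e k = y%:M ->
  lincomb (squares e) (map_mx (fun z => z ^+ 2) k) = (y ^+ 2)%:M.
Proof.
move=> ky; pose frob := pFrobenius_aut chL.
have -> : (y ^+ 2)%:M = map_mx frob (y%:M : 'M_1) by rewrite map_scalar_mx.
rewrite -ky /lincomb map_mxM; congr (_ *m _).
by apply/rowP=> i; rewrite !mxE rmorphXn.
Qed.

Lemma exists_independent (s : seq L) : exists N (e : 'cV[L]_N),
  [/\ forall i, e i 0 \in s, independent e
    & forall y, y \in s -> exists k, lincomb e k = y%:M].
Proof.
elim: s => [|x s [N [e [es ei eg]]]].
  exists 0%N, 0; split=> // [[]//|k _]; exact: thinmx0.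
have [[k xk]|nx] := classic (exists k, lincomb e k = x%:M).
  exists N, e; split=> // [i|y]; first by rewrite inE es orbT.
  by rewrite inE => /predU1P [->|/eg //]; exists k.
exists (1 + N)%N, (col_mx x%:M e); split=> [i|k|y].
- rewrite mxE; case: splitP => j _; first by rewrite mxE !ord1 mem_head.
  by rewrite inE es orbT.
- rewrite /lincomb -[k]hsubmxK map_row_mx mul_row_col.
  move: (lsubmx k) (rsubmx k) => l r.
  rewrite [l]mx11_scalar map_scalar_mx mul_scalar_mx scale_scalar_mx.
  set c := l 0 0 => lr; have c0 : c = 0.
    apply/eqP; apply: contraT => c0; case: nx; exists (- c^-1 *: r).
    rewrite lincombZ; move/eqP: lr; rewrite addrC addr_eq0 /lincomb => /eqP ->.
    rewrite rmorphN fmorphV scaleNr scalerN opprK scale_scalar_mx mulKf //.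
    by rewrite fmorph_eq0.
  move: lr; rewrite c0 rmorph0 mul0r raddf0 add0r => /ei ->.
  by rewrite raddf0 row_mx0.
- rewrite inE => /predU1P [->|/eg [k ky]].
    exists (row_mx 1%:M 0).
    by rewrite /lincomb map_row_mx mul_row_col map_mx1 mul1mx map_mx0 mul0mx addr0.
  exists (row_mx 0 k).
  by rewrite /lincomb map_row_mx mul_row_col map_mx0 mul0mx add0r.
Qed.

(** [e] is a basis of the span of a list spanned by its own squares. The squares of [e] then span
    [e], and being equally many they are independent. *)
Lemma exists_independent_squares (s : seq L) : separable_algebraic_ext f ->
  exists N (e : 'cV[L]_N), [/\ independent e, independent (squares e)
    & forall y, y \in s -> (exists k, lincomb e k = y%:M) /\
                           (exists k, lincomb (squares e) k = y%:M)].
Proof.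
move=> sep; have [t [st tP]] := seq_spanned_by_squares s sep.
have [N [e [et ei eg]]] := exists_independent t.
have sqg y : y \in t -> exists k, lincomb (squares e) k = y%:M.
  apply: (tP (fun y => exists k, lincomb (squares e) k = y%:M)).
    split=> [|u v [k ku] [l lv]|c u [k ku]].
    - by exists 0; rewrite /lincomb map_mx0 mul0mx raddf0.
    - by exists (k + l); rewrite lincombD ku lv raddfD.
    - by exists (c *: k); rewrite lincombZ ku scale_scalar_mx.
  move=> w /eg [k kw]; eexists; exact: lincomb_squares kw.
exists N, e; split=> // [|y /st yt]; last by split; [exact: eg | exact: sqg].
have [K KE] := fin_all_exists (fun i => sqg _ (et i)).
pose KM := \matrix_i K i.
have eE (k : 'rV_N) : lincomb (squares e) (k *m KM) = lincomb e k.
  rewrite mulmx_sum_row lincomb_sum /lincomb [RHS]mulmx_sum_row.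
  apply: eq_bigr => i _; rewrite rowK -/(lincomb _ _) lincombZ KE mxE.
  by congr (_ *: _); apply/matrixP => a b; rewrite !ord1 !mxE.
have KMu : KM \in unitmx.
  rewrite -row_free_unit -kermx_eq0; apply/eqP/row_matrixP => i; rewrite row0.
  apply: ei; rewrite -eE -row_mul mulmx_ker row0.
  by rewrite /lincomb map_mx0 mul0mx.
move=> k; rewrite -{1}[k](mulmxKV KMu) eE => /ei kK.
by rewrite -[k](mulmxKV KMu) kK mul0mx.
Qed.

(* Comparing coefficients along [e] and along its squares: the relations below
   are linear in [c] and in the squares of the entries of [M] and [N], and
   linear in these entries. *)
Lemma similarity_descent n (a b : 'rV[F]_n) (c : L) (M N : 'M[L]_n) :
  separable_algebraic_ext f -> c != 0 ->
  (forall x, ts_form (map_mx f a) (x *m M) = c * ts_form (map_mx f b) x) ->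
  (forall x, ts_form (map_mx f b) (x *m N) = c * ts_form (map_mx f a) x) ->
  exists (c' : F) (M' N' : 'M[F]_n), [/\ c' != 0,
    forall x, ts_form a (x *m M') = c' * ts_form b x,
    forall x, ts_form b (x *m N') = c' * ts_form a x &
    forall A B : 'M[F]_n, M *m map_mx f A = map_mx f B *m N^T ->
      M' *m A = B *m N'^T].
Proof.
move=> sep c0 MP NP.
pose ent (P : 'M[L]_n) := codom (fun ij : 'I_n * 'I_n => P ij.1 ij.2).
have [d [e [ei e2i eg]]] := exists_independent_squares (c :: ent M ++ ent N) sep.
have [_ [kc kcE]] := eg c (mem_head _ _).
have coef (P : 'M[L]_n) : {subset ent P <= c :: ent M ++ ent N} ->
    exists k : 'I_n * 'I_n -> 'rV[F]_d, forall ij, lincomb e (k ij) = (P ij.1 ij.2)%:M.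
  move=> sP; have kP ij : exists k, lincomb e k = (P ij.1 ij.2)%:M.
    by case: (eg (P ij.1 ij.2)) => //; apply/sP/(codom_f _ ij).
  by case: (fin_all_exists kP) => k kE; exists k.
have [|kM kME] := coef M; first by move=> y yM; rewrite inE mem_cat yM orbT.
have [|kN kNE] := coef N; first by move=> y yN; rewrite inE mem_cat yN !orbT.
(* All coefficients are compared at an index [p] where [c] has a nonzero coordinate along the
   squares. *)
have /rV0Pn [p kcp] : kc != 0.
  apply: contraNneq c0 => kc0; move: kcE; rewrite kc0 /lincomb map_mx0 mul0mx.
  by move/matrixP/(_ 0 0); rewrite !mxE eqxx mulr1n => <-.
(* The square of the [p]-th coordinate of an entry along [e] is the [p]-th coordinate of the squared
   entry along [squares e], where [c] is expanded too. *)
pose comp (k : 'I_n * 'I_n -> 'rV[F]_d) := \matrix_(i, j) k (i, j) 0 p.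
have quad (u v : 'rV[F]_n) (P : 'M[L]_n) k :
    (forall ij, lincomb e (k ij) = (P ij.1 ij.2)%:M) ->
    (forall x, ts_form (map_mx f u) (x *m P) = c * ts_form (map_mx f v) x) ->
    forall x, ts_form u (x *m comp k) = kc 0 p * ts_form v x.
  move=> kE /(ts_form_similarityP chL) PP; apply/(ts_form_similarityP ch) => i.
  pose r := \sum_j u 0 j *: map_mx (fun z => z ^+ 2) (k (i, j)) - v 0 i *: kc.
  have : r = 0.
    apply: e2i; rewrite /r lincombD lincomb_sum -scaleNr lincombZ kcE.
    have := PP i; rewrite /ts_form mxE => PPi.
    rewrite scale_scalar_mx rmorphN mulNr mulrC -PPi.
    rewrite raddfN raddf_sum /=; apply/eqP; rewrite subr_eq0; apply/eqP.
    apply: eq_bigr => j _; rewrite lincombZ (lincomb_squares (kE (i, j))).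
    by rewrite scale_scalar_mx !mxE.
  move/rowP/(_ p); rewrite !mxE summxE => /eqP; rewrite subr_eq0 mulrC => /eqP <-.
  by apply: eq_bigr => j _; rewrite !mxE.
exists (kc 0 p), (comp kM), (comp kN); split=> //.
- exact: quad.
- exact: quad.
move=> A B MN; apply/matrixP => i j.
pose r := \sum_l A l j *: kM (i, l) - \sum_l B i l *: kN (j, l).
have : r = 0.
  apply: ei; rewrite /r lincombD -scaleN1r lincombZ !lincomb_sum rmorphN1 scaleN1r.
  apply/eqP; rewrite subr_eq0; apply/eqP.
  have := congr1 (fun P : 'M_n => (P i j)%:M : 'M[L]_1) MN; rewrite !mxE !raddf_sum /= => E.
  apply: etrans (etrans E _); apply: eq_bigr => l _; rewrite lincombZ.
    by rewrite kME scale_scalar_mx !mxE mulrC.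
  by rewrite kNE scale_scalar_mx !mxE.
move/rowP/(_ p); rewrite !mxE !summxE => /eqP; rewrite subr_eq0 => /eqP E.
apply: etrans (etrans E _); apply: eq_bigr => l _; rewrite !mxE //.
by rewrite mulrC.
Qed.

End Descent.

(** * Linear isomorphisms, Gram matrices and the equivalence of similarities *)

Lemma lin_iso_dim (E : fieldType) (m n : nat) (M : 'M[E]_(m, n)) : lin_iso M -> m = n.
Proof. by case/andP=> /eqP rf /eqP rg; rewrite -[LHS]rf. Qed.

Lemma lin_iso_unitmx (E : fieldType) (n : nat) (M : 'M[E]_n) :
  lin_iso M = (M \in unitmx).
Proof. by rewrite /lin_iso row_free_unit row_full_unit andbb. Qed.

Lemma bil_form_similarityP (E : fieldType) (n m : nat) (A : 'M[E]_n) (B : 'M[E]_m)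
    (M : 'M[E]_(m, n)) c :
  (forall x y : 'rV[E]_m, bil_form A (x *m M) (y *m M) = c * bil_form B x y) <->
  M *m A *m M^T = c *: B.
Proof.
have bE (x y : 'rV[E]_m) :
    bil_form A (x *m M) (y *m M) = (x *m (M *m A *m M^T) *m y^T) 0 0.
  by rewrite /bil_form trmx_mul !mulmxA.
split=> [H|H x y]; last by rewrite bE H -scalemxAr -scalemxAl mxE.
apply/matrixP=> i j; have := H 'e_i 'e_j.
by rewrite bE /bil_form !trmx_delta -!rowE -!colE !mxE.
Qed.

Lemma ts_form_map (E E' : fieldType) (f : {rmorphism E -> E'}) (n : nat)
    (a x : 'rV[E]_n) : ts_form (map_mx f a) (map_mx f x) = f (ts_form a x).
Proof.
rewrite /ts_form rmorph_sum; apply: eq_bigr => i _.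
by rewrite !mxE rmorphM rmorphXn.
Qed.

(** Scaling the inverse by [c] turns its factor [c^-1] into [c], so that both maps carry the same
    scalar. *)
Lemma ts_form_inv_similarity (E : fieldType) (n : nat) (a b : 'rV[E]_n)
    (M : 'M[E]_n) c : M \in unitmx ->
  (forall x, ts_form a (x *m M) = c * ts_form b x) ->
  forall x, ts_form b (x *m (c *: invmx M)) = c * ts_form a x.
Proof.
move=> Mu MP x; rewrite -scalemxAr ts_formZ -[in RHS](mulmxKV Mu x) MP.
by rewrite mulrA expr2.
Qed.

Theorem theorem5p2 (F L : fieldType) (iota : {rmorphism F -> L}) :
  2%N \in [pchar F] ->
  separable_algebraic_ext iota ->
  (forall (n m : nat) (a : 'rV[F]_n) (b : 'rV[F]_m),
      ts_similar a b <-> ts_similar (map_mx iota a) (map_mx iota b)) /\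
  (forall (n m : nat) (A : 'M[F]_n) (B : 'M[F]_m),
      nonsingular_sym_bil A -> nonsingular_sym_bil B ->
      bil_similar A B <-> bil_similar (map_mx iota A) (map_mx iota B)).
Proof.
move=> ch sep; have chL : 2%N \in [pchar L] by rewrite (fmorph_pchar iota).
split=> [n m a b|n m A B nsA nsB]; split.
- case=> c [M [c0 [Miso MP]]]; exists (iota c), (map_mx iota M).
  rewrite fmorph_eq0 /lin_iso row_free_map row_full_map; do 2!split=> //.
  apply/(ts_form_similarityP chL) => j; rewrite -map_row ts_form_map mxE -rmorphM.
  by congr (iota _); apply: ((ts_form_similarityP ch a b M c).1 MP).
- case=> c [M [c0 [Miso MP]]]; have mn := lin_iso_dim Miso.
  subst m; rewrite lin_iso_unitmx in Miso.
  have NP := ts_form_inv_similarity Miso MP.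
  have [c' [M' [N' [c'0 M'P N'P _]]]] := similarity_descent ch sep c0 MP NP.
  have [P Pu PP] := ts_similar_of_maps ch c'0 M'P N'P.
  by exists c', P; rewrite lin_iso_unitmx.
- case=> c [M [c0 [Miso /bil_form_similarityP MP]]].
  exists (iota c), (map_mx iota M).
  rewrite fmorph_eq0 /lin_iso row_free_map row_full_map; do 2!split=> //.
  by apply/bil_form_similarityP; rewrite map_trmx -!map_mxM MP map_mxZ.
- case=> c [M [c0 [Miso /bil_form_similarityP MP]]]; have mn := lin_iso_dim Miso.
  subst m; rewrite lin_iso_unitmx in Miso.
  have [As Au] := nsA; have [Bs Bu] := nsB.
  have diagE (C : 'M[F]_n) : \row_i map_mx iota C i i = map_mx iota (\row_i C i i).
    by apply/rowP => i; rewrite !mxE.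
  have LP x : ts_form (map_mx iota (\row_i A i i)) (x *m M)
      = c * ts_form (map_mx iota (\row_i B i i)) x.
    have q (C : 'M[F]_n) : C^T = C -> forall z : 'rV[L]_n,
        ts_form (map_mx iota (\row_i C i i)) z = (z *m map_mx iota C *m z^T) 0 0.
      move=> Cs z; rewrite (sym_diag_ts_form chL) ?map_trmx ?Cs //.
      by rewrite mxE eqxx mulr1n diagE.
    rewrite !q //.
    have -> : x *m M *m map_mx iota A *m (x *m M)^T
        = x *m (M *m map_mx iota A *m M^T) *m x^T by rewrite trmx_mul !mulmxA.
    by rewrite MP -scalemxAr -scalemxAl mxE.
  have NP := ts_form_inv_similarity Miso LP.
  have [c' [M' [N' [c'0 M'P N'P lin]]]] := similarity_descent ch sep c0 LP NP.
  have MN : M' *m A = B *m N'^T.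
    (* With [N = c M^-1], the relation is [M A M^T = c B] multiplied on the right by the inverse of
       [M^T]. *)
    apply: lin; rewrite linearZ /= -scalemxAr scalemxAl -MP trmx_inv mulmxK //.
    by rewrite unitmx_tr.
  have [P Pu PP] := bil_similar_of_maps ch c'0 nsA nsB M'P N'P MN.
  exists c', P; rewrite lin_iso_unitmx; do 2!split=> //.
  exact/bil_form_similarityP.
Qed.
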